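(* Suppose Borel probability measures $\{\mu_n\}$ on a metric space $(\mathcal{X},d)$ satisfy the large deviation principle (LDP) with rate $a_n\to0$ and good rate function $I(\cdot)$. Fix a metric space $(\mathbb{S},\rho)$, a continuous map $f:(\mathcal{X},d)\to(\mathbb{S},\rho)$ and $s\in\mathbb{S}$. For every $\eta>0$ let $\mathcal{B}^o_{f,s,\eta}=\{x\in\mathcal{X}:\rho(s,f(x))<\eta\}$, and let $Z_n^\eta$ denote random variables of the law \[ \nu_n^\eta:=\mu_n\left(\cdot\mid\mathcal{B}^o_{f,s,\eta}\right). \] (a) If \[ \lim_{n\to\infty}a_n\log\mu_n(\mathcal{B}^o_{f,s,\eta})=0\qquad\text{for every fixed }\eta>0, \tag{L} \] then for the good rate function \[ J_0(x):=\begin{cases}I(x),&f(x)=s,\\ \infty,&\text{otherwise,}\end{cases} \] and any open $U\subset\mathcal{X}$ and closed $F\subset\mathcal{X}$, \[ \liminf_{\eta\to0}\liminf_{n\to\infty}a_n\log\nu_n^\eta(U)\ge-\inf_{x\in U}J_0(x), \] \[ \limsup_{\eta\to0}\limsup_{n\to\infty}a_n\log\nu_n^\eta(F)\le-\inf_{x\in F}J_0(x). \] (b) Suppose (L) holds and that $\{Z_n^\eta\}$ form an exponentially good approximation of variables $Z_n\sim\nu_n$; i.e., for any $\delta>0$ there exist couplings $\mathbb{P}_{n,\eta}$ of $(Z_n,Z_n^\eta)$ so that \[ \lim_{\eta\downarrow0}\limsup_{n\to\infty}a_n\log\mathbb{P}_{n,\eta}\left(d(Z_n,Z_n^\eta)>\delta\right)=-\infty.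 \] Then $\{\nu_n\}$ satisfy the LDP with rate $a_n\to0$ and the good rate function $J_0(\cdot)$.
   Context: Here $a_n>0$. Borel probability measures $\{\mu_n\}$ on a metric space $\mathcal{X}$ satisfy the LDP with rate $a_n\to0$ and rate function $I:\mathcal{X}\to[0,\infty]$ if $\limsup_{n\to\infty}a_n\log\mu_n(F)\le-\inf_{x\in F}I(x)$ for every closed $F$ and $\liminf_{n\to\infty}a_n\log\mu_n(U)\ge-\inf_{x\in U}I(x)$ for every open $U$. The rate function is good if all its level sets $\{x:I(x)\le\alpha\}$, $\alpha<\infty$, are compact. Conventions: $\inf\emptyset=+\infty$ and $\log0=-\infty$. The measures $\nu_n$ in part (b) are Borel probability measures on $\mathcal{X}$; a coupling of $(Z_n,Z_n^\eta)$ is a joint law with marginals $\nu_n$ and $\nu_n^\eta$, for which the events $\{d(Z_n,Z_n^\eta)>\delta\}$ are measurable (as in the standard definition of exponentially good approximations). The conditional law $\nu_n^\eta$ is considered whenever $\mu_n(\mathcal{B}^o_{f,s,\eta})>0$, which under (L) holds for each $\eta>0$ and all $n$ large enough. *)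

(* Defs.v *)
From HB Require Import structures.
From mathcomp Require Import all_boot all_order all_algebra.
From mathcomp Require Import all_classical all_reals all_analysis.

Set Implicit Arguments.
Unset Strict Implicit.
Unset Printing Implicit Defensive.

Import Order.TTheory GRing.Theory Num.Theory.
Import numFieldNormedType.Exports.

Local Open Scope classical_set_scope.
Local Open Scope ring_scope.

(* Measurable types are pointed in the library.  Pointedness costs nothing here,
   since a space carrying a probability measure is nonempty. *)
#[short(type="pmetricType")]
HB.structure Definition PMetric (K : numDomainType) :=
  { M of Metric K M & Pointed M }.

Notation borel X := (g_sigma_algebraType (@open X)).

Section ldp.
Context {R : realType} {X : pmetricType R}.
Implicit Types (a : nat -> R) (I : X -> \bar R) (B : set X).
Local Open Scope ereal_scope.

Definition log_rate a (n : nat) (p : \bar R) : \bar R := (a n)%:E * lne p.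

(* Compact sets are closed in a metric space, so compact level sets also give
   lower semicontinuity. *)
Definition good_rate_function I : Prop :=
  (forall x, 0 <= I x) /\
  (forall alpha : R, compact [set x | I x <= alpha%:E]).

Definition ldp a (mu : nat -> probability (borel X) R) I : Prop :=
  (forall F : set X, closed F ->
     limn_esup (fun n => log_rate a n (mu n F)) <= - ereal_inf (I @` F)) /\
  (forall U : set X, open U ->
     - ereal_inf (I @` U) <= limn_einf (fun n => log_rate a n (mu n U))).

(* When [mu B = 0] this is the zero function, which is not a probability. *)
Definition cond_law (mu : probability (borel X) R) B (A : set X) : \bar R :=
  mu (A `&` B) / mu B.

(* Two random elements of X on a common probability space.  The joint law need
   not live on the product sigma-algebra, for which the distance may fail to be
   measurable when X is not separable. *)
Record random_pair := RandomPair {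
  rp_disp : measure_display ;
  rp_space : measurableType rp_disp ;
  rp_prob : probability rp_space R ;
  rp_fst : {mfun rp_space >-> borel X} ;
  rp_snd : {mfun rp_space >-> borel X} }.

Definition coupling (p : random_pair) (nu1 nu2 : set X -> \bar R) : Prop :=
  (forall A : set (borel X), measurable A ->
     distribution (rp_prob p) (rp_fst p) A = nu1 A) /\
  (forall A : set (borel X), measurable A ->
     distribution (rp_prob p) (rp_snd p) A = nu2 A).

Definition far (p : random_pair) (delta : R) : set (rp_space p) :=
  [set w | (delta < mdist (rp_fst p w : X) (rp_snd p w : X))%R].
Arguments far : clear implicits.

(* The laws [cond_law (mu n) (B eta)] are exponentially good approximations of
   [nu n].  The family [p] is constrained only at the pairs (n, eta) for which
   the conditional law exists. *)
Definition exp_good_approx a (mu : nat -> probability (borel X) R)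
    (B : R -> set X) (nu : nat -> probability (borel X) R) : Prop :=
  forall delta : R, (0 < delta)%R ->
  exists p : nat -> R -> random_pair,
    (forall (n : nat) (eta : R), (0 < eta)%R -> 0 < mu n (B eta) ->
       coupling (p n eta) (nu n) (cond_law (mu n) (B eta)) /\
       measurable (far (p n eta) delta)) /\
    limn_esup (fun n =>
      log_rate a n (rp_prob (p n eta) (far (p n eta) delta)))
      @[eta --> 0^'+] --> -oo.

End ldp.
Arguments random_pair {R} X.
Arguments far {R X} p delta.

Section constraint.
Context {R : realType} {X : pmetricType R} {S : metricType R}.
Variables (f : X -> S) (s : S).
Local Open Scope ereal_scope.

Definition fball (eta : R) : set X := [set x | (mdist s (f x) < eta)%R].

Definition J0 (I : X -> \bar R) (x : X) : \bar R :=
  if f x == s then I x else +oo.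

Definition fball_negligible_cost (a : nat -> R)
    (mu : nat -> probability (borel X) R) : Prop :=
  forall eta : R, (0 < eta)%R ->
    log_rate a n (mu n (fball eta)) @[n --> \oo] --> 0.

End constraint.

(* Main.v *)
Require Import Defs.
From HB Require Import structures.
From mathcomp Require Import all_boot all_order all_algebra.
From mathcomp Require Import all_classical all_reals all_analysis.
From mathcomp Require Import lra.

Import Order.TTheory GRing.Theory Num.Theory.
Import numFieldNormedType.Exports.

Local Open Scope classical_set_scope.
Local Open Scope ring_scope.
Local Open Scope ereal_scope.

(* On the logarithmic scale, conditioning on [fball eta] costs nothing by (L), so
   the conditional laws inherit the bounds of [mu] on [U `&` fball eta] and on
   [F `&` {rho (s, f) <= eta}].  The lower bound is then immediate.  For the upper
   bound, if [c < inf_F J0] then [f <> s] on the compact set [{I <= c} `&` F], so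
   [rho (s, f)] is bounded away from [0] there, and [inf I >= c] on
   [F `&` {rho (s, f) <= eta}] for all small [eta].  For (b), the coupling gives
   [nu F <= cond_law (thickening F d) + P far] and
   [cond_law (ball x d) <= nu (ball x (2 d)) + P far], where the last term is
   superexponentially small for small [eta]; compactness of the level sets of
   [J0] allows thickening [F] at arbitrarily small loss. *)

(** * Real thresholds for extended reals; limits superior and inferior along filters *)

Section ereal_facts.
Context {R : realType}.
Implicit Types x y : \bar R.

Lemma lte_EFin_between {x y} : x < y -> exists2 c : R, x < c%:E & c%:E < y.
Proof.
case: x y => [x||] [y||]//.
- by rewrite lte_fin => xy; exists ((x + y) / 2)%R; rewrite lte_fin midf_lt.
- by exists (x + 1)%R; rewrite ?ltry// lte_fin ltrDl.
- by exists (y - 1)%R; rewrite ?ltNyr// lte_fin gtrBl.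
- by exists 0%R; rewrite ?ltry ?ltNyr.
Qed.

(** Testing against real [c] only lets later bounds avoid case analysis on infinite values. *)
Lemma lee_EFin_gt x y : (forall c : R, y < c%:E -> x <= c%:E) -> x <= y.
Proof.
move=> H; rewrite leNgt; apply/negP => /lte_EFin_between[c yc cx].
by have := H _ yc; rewrite leNgt cx.
Qed.

Lemma lee_EFin_lt x y : (forall c : R, c%:E < x -> c%:E <= y) -> x <= y.
Proof.
move=> H; rewrite leNgt; apply/negP => /lte_EFin_between[c yc cx].
by have := H _ cx; rewrite leNgt yc.
Qed.

Context {T : choiceType} {X : filteredType T}.
Implicit Types (h : X -> \bar R) (F : set_system X).

Lemma near_limf_esup_lt h F c : Filter F ->
  limf_esup h F < c -> \near F, h F < c.
Proof.
move=> FF /ereal_inf_lt[_ [V FV <-]] hc.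
apply: (@filterS _ F FF V) => // v Vv; apply: le_lt_trans hc.
by apply: ereal_sup_ubound; exists v.
Qed.

Lemma limf_esup_le_near h F c : (\near F, h F <= c) -> limf_esup h F <= c.
Proof.
move=> hc; apply: ge_ereal_inf; exists (ereal_sup (h @` [set x | h x <= c])).
  by exists [set x | h x <= c].
by apply: ge_ereal_sup => _ [x xc <-].
Qed.

Lemma near_limf_einf_gt h F c : Filter F ->
  c < limf_einf h F -> \near F, c < h F.
Proof.
move=> FF; rewrite /limf_einf lteNr => /near_limf_esup_lt.
by apply: filterS => x; rewrite lteN2.
Qed.

Lemma limf_einf_ge_near h F c : Filter F -> (\near F, c <= h F) -> c <= limf_einf h F.
Proof.
move=> FF ch; rewrite /limf_einf leeNr; apply: limf_esup_le_near.
by apply: filterS ch => x; rewrite leeN2.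
Qed.

End ereal_facts.

(** * Calculus on the logarithmic scale *)

Section log_rate.
Context {R : realType} {a : nat -> R}.
Hypothesis a_gt0 : forall n, (0 < a n)%R.

(** Divide by [a n] and exponentiate. The form with [expR] covers [p = 0] and [p = +oo] too, so sums
    and quotients can be estimated without logarithms. *)
Lemma log_rate_le_expR n (p : \bar R) c : 0 <= p ->
  (log_rate a n p <= c%:E) = (p <= (expR (c / a n))%:E).
Proof.
move=> p0; rewrite /log_rate muleC -lee_pdivlMr// -EFinM.
rewrite -[in RHS](@lee_lne R) ?in_itv/= ?p0 ?leey ?lee_fin ?expR_ge0//.
by rewrite (leNgt (expR _)) expR_gt0/= expRK.
Qed.

Lemma log_rate_mono n (p q : \bar R) : 0 <= p -> p <= q ->
  log_rate a n p <= log_rate a n q.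
Proof.
move=> p0 pq; apply: lee_EFin_gt => c /ltW.
rewrite !log_rate_le_expR ?(le_trans p0)//; exact: le_trans.
Qed.

Lemma log_rate_gt_gt0 n (p : \bar R) c : c%:E < log_rate a n p -> 0 < p.
Proof.
rewrite ltNge => H; rewrite ltNge; apply: contra H => p0.
by rewrite /log_rate le0_lneNy// gt0_muleNy ?lte_fin// leNye.
Qed.

Lemma near_log_rate_gt (q : nat -> \bar R) c : (c < 0)%R ->
  log_rate a n (q n) @[n --> \oo] --> 0 ->
  \forall n \near \oo, c%:E < log_rate a n (q n).
Proof.
move=> c0 qL; apply: near_limf_einf_gt; rewrite (_ : limf_einf _ _ = 0) ?lte_fin//.
exact: (cvg_limn_einf_sup qL).1.
Qed.

(* The principle of the largest term, for two summands. *)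
Lemma near_log_rateD c d : a @ \oo --> (0 : R)%R -> (c < d)%R ->
  \forall n \near \oo, forall p q : \bar R, 0 <= p -> 0 <= q ->
    log_rate a n p <= c%:E -> log_rate a n q <= c%:E ->
    log_rate a n (p + q) <= d%:E.
Proof.
(* The sum is at most [2 * expR (c / a n)], and the factor 2 is absorbed once [a n * ln 2 < d - c],
   uniformly in [p] and [q]. *)
move=> a0 cd; have e0 : (0 < (d - c) / ln 2)%R.
  by rewrite divr_gt0 ?subr_gt0// ln_gt0// ltr1n.
have : \forall n \near \oo, (a n < (d - c) / ln 2)%R by exact: cvgr_lt a0 _ e0.
apply: filterS => n an p q p0 q0.
rewrite !log_rate_le_expR ?adde_ge0// => pc qc.
apply: (le_trans (leeD pc qc)); rewrite -EFinD lee_fin -mulr2n -mulr_natl.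
rewrite -[X in (X * _)%R](@lnK R) ?posrE// -expRD ler_expR.
rewrite ler_pdivlMr// mulrDl divfK ?gt_eqF// -lerBrDr mulrC.
by rewrite -ler_pdivlMr ?ln_gt0 ?ltr1n// ltW.
Qed.

(** Eventually [q n > expR ((c - d) / a n)], so the division costs at most the factor
    [expR ((d - c) / a n)]. *)
Lemma near_log_rate_div (c d : R) (p q : nat -> \bar R) : (c < d)%R ->
  (forall n, 0 <= p n) -> (forall n, q n \is a fin_num) ->
  log_rate a n (q n) @[n --> \oo] --> 0 ->
  (\forall n \near \oo, log_rate a n (p n) <= c%:E) ->
  \forall n \near \oo, log_rate a n (p n / q n) <= d%:E.
Proof.
move=> cd p0 qfin qL pc; have cd0 : (c - d < 0)%R by rewrite subr_lt0.
have := near_log_rate_gt _ _ cd0 qL; apply: filter_app; apply: filterS pc => n pcn qdn.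
have := log_rate_gt_gt0 _ _ _ qdn; move: qdn.
case: (q n) (qfin n) => // r _ qdn; rewrite lte_fin => r0; move: qdn.
rewrite ltNge log_rate_le_expR; last by rewrite lee_fin ltW.
rewrite -ltNge lte_fin => qdn.
rewrite inver gt_eqF// log_rate_le_expR; last first.
  by rewrite mule_ge0// lee_fin invr_ge0 ltW.
rewrite lee_pdivrMr//; move: pcn; rewrite log_rate_le_expR// => /le_trans; apply.
rewrite -EFinM lee_fin; apply: le_trans (ler_wpM2l (expR_ge0 _) (ltW qdn)).
by rewrite -expRD -mulrDl addrC subrK.
Qed.

End log_rate.

(** * Distances and the thickening of closed sets *)

Section metric_facts.
Context {R : realType} {M : metricType R}.
Implicit Types (x y : M) (F K : set M).

Lemma continuous_mdist x : continuous (mdist x : M -> R).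
Proof.
move=> y; apply/cvgrPdist_lt => e e0.
near=> z; have yz : (mdist y z < e)%R.
  by near: z; have := nbhsx_ballx y e e0; rewrite ballEmdist.
rewrite ltr_norml.
have := metric_triangle x y z; have := metric_triangle x z y.
by rewrite (metric_sym z y) => h1 h2; apply/andP; split; lra.
Unshelve. all: by end_near. Qed.

(* The closure spares a proof that the set [{y | d(y, F) <= d}] is closed. *)
Definition thickening F (d : R) : set M :=
  closure [set y | exists2 x, F x & (mdist x y <= d)%R].

(** Each point of [K] has a neighbourhood at positive distance from [F]; compactness, as a
    near-covering property, makes this distance uniform on [K]. *)
Lemma thickening_disjoint {K F} : compact K -> closed F -> K `&` F = set0 ->
  exists2 d : R, (0 < d)%R & K `&` thickening F d = set0.
Proof.
move=> /compact_near_coveringP Kc Fc KF.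
(* The factor 2 pays for the closure: a point of [thickening F d] is at distance less than [d] from
   a point within [d] of [F]. *)
have : \forall d \near (0 : R)^'+,
    K `<=` [set x | forall y, F y -> (2 * d <= mdist x y)%R].
  apply: (Kc R _ (fun d x => forall y, F y -> (2 * d <= mdist x y)%R)) => x Kx.
  have : nbhs x (~` F).
    apply: open_nbhs_nbhs; split; first exact: closed_openC.
    by move=> Fx; have : (K `&` F) x by []; rewrite KF.
  move=> /nbhs_ballP[e /= e0]; rewrite ballEmdist => xeF.
  (* If [z] is within [e / 4] of [x], its distance to [F] is at least [3 * e / 4], which exceeds
     [2 * d] for [d < e / 4]. *)
  have e4 : (0 < e / 4)%R by rewrite divr_gt0.
  near=> z d => y Fy.
  have dz : (mdist x z < e / 4)%R.
    by near: z; have := nbhsx_ballx x _ e4; rewrite ballEmdist.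
  have de : (d < e / 4)%R by near: d; exact: nbhs_right_lt.
  have xy : (e <= mdist x y)%R by rewrite leNgt; apply/negP => /xeF; exact.
  by have := metric_triangle x z y; rewrite /=; lra.
move=> Kd; have [d [d0 {}Kd]] : exists d : R, (0 < d)%R /\
    K `<=` [set x | forall y, F y -> (2 * d <= mdist x y)%R].
  near (0 : R)^'+ => d; exists d; split; near: d => //.
  exact: nbhs_right_gt.
exists d => //; rewrite -subset0 => x [Kx].
move=> /(_ _ (nbhsx_ballx x _ d0))[z [[y Fy yz]]]; rewrite ballEmdist/= => xz.
have := Kd _ Kx _ Fy; have := metric_triangle x z y.
by rewrite (metric_sym z y); lra.
Unshelve. all: by end_near. Qed.

End metric_facts.

(** * Borel sets and estimates from couplings *)

Section borel_facts.
Context {R : realType} {X : pmetricType R}.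

Lemma borel_open (U : set X) : open U -> measurable (U : set (borel X)).
Proof. exact: sub_sigma_algebra. Qed.

Lemma borel_closed (F : set X) : closed F -> measurable (F : set (borel X)).
Proof.
move=> Fc; rewrite -(setCK F); apply: measurableC; apply: borel_open.
exact: closed_openC.
Qed.

Lemma near_far_le (P : nat -> R -> random_pair X) (a : nat -> R) (d c : R) :
  limn_esup (fun n => log_rate a n (rp_prob (P n eta) (far (P n eta) d)))
    @[eta --> 0^'+] --> -oo ->
  \forall eta \near 0^'+, \forall n \near \oo,
    log_rate a n (rp_prob (P n eta) (far (P n eta) d)) <= c%:E.
Proof.
move=> /cvgeNyPlt/(_ c); apply: filterS => eta /near_limf_esup_lt.
by apply: filterS => n /ltW.
Qed.

Section coupling.
Context {p : random_pair X} {nu1 nu2 : set X -> \bar R} {d : R} {A B : set X}.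
Hypothesis p_coupling : coupling p nu1 nu2.
Hypothesis mfar : measurable (far p d).
Hypothesis mA : measurable (A : set (borel X)).
Hypothesis mB : measurable (B : set (borel X)).

(** Outside [far p d] the two variables are within [d], so the first in [A] forces the second in
    [B]; subadditivity concludes. *)
Lemma coupling_le_fst : (forall x y, A x -> (mdist x y <= d)%R -> B y) ->
  nu1 A <= nu2 B + rp_prob p (far p d).
Proof.
move=> AB; rewrite -(p_coupling.1 _ mA) -(p_coupling.2 _ mB).
have mfA : measurable (rp_fst p @^-1` A) by exact: measurable_funPTI.
have mfB : measurable (rp_snd p @^-1` B) by exact: measurable_funPTI.
apply: le_trans (measureU2 _ mfB mfar); rewrite /distribution/= /pushforward.
apply: le_measure; rewrite ?inE//; first exact: measurableU.
move=> w /= Aw; have [fw|fw] := ltP d (mdist (rp_fst p w : X) (rp_snd p w)).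
  by right.
by left; exact: AB fw.
Qed.

Lemma coupling_le_snd : (forall x y, A y -> (mdist x y <= d)%R -> B x) ->
  nu2 A <= nu1 B + rp_prob p (far p d).
Proof.
move=> AB; rewrite -(p_coupling.2 _ mA) -(p_coupling.1 _ mB).
have mfA : measurable (rp_snd p @^-1` A) by exact: measurable_funPTI.
have mfB : measurable (rp_fst p @^-1` B) by exact: measurable_funPTI.
apply: le_trans (measureU2 _ mfB mfar); rewrite /distribution/= /pushforward.
apply: le_measure; rewrite ?inE//; first exact: measurableU.
move=> w /= Aw; have [fw|fw] := ltP d (mdist (rp_fst p w : X) (rp_snd p w)).
  by right.
by left; exact: AB fw.
Qed.

End coupling.
End borel_facts.

(** * The constraint and the rate function [J0] *)

Section constrained_ldp.
Context {R : realType} {X : pmetricType R} {S : metricType R}.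
Context {a : nat -> R} {mu : nat -> probability (borel X) R} {I : X -> \bar R}.
Context {f : X -> S} {s : S}.
Hypothesis a_gt0 : forall n : nat, (0 < a n)%R.
Hypothesis a_cvg0 : a @ \oo --> (0 : R)%R.
Hypothesis I_good : good_rate_function I.
Hypothesis mu_ldp : ldp a mu I.
Hypothesis f_cont : continuous f.
Local Notation J := (J0 f s I).
Local Notation B := (fball f s).

Lemma continuous_constraint : continuous (fun x => mdist s (f x) : R).
Proof.
by move=> x; apply: continuous_comp; [exact: f_cont|exact: continuous_mdist].
Qed.

Lemma fball_open eta : open (B eta).
Proof.
apply: (@open_comp _ _ (fun x => mdist s (f x)) [set r : R | (r < eta)%R]) => //.
by move=> x _; exact: continuous_constraint.
Qed.

Lemma closed_constraint eta : closed [set x | (mdist s (f x) <= eta)%R].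
Proof.
apply: (@preimage_closed _ _ (fun x => mdist s (f x)) [set r : R | (r <= eta)%R]).
  by move=> x _; exact: continuous_constraint.
exact: closed_le.
Qed.

Lemma J0_good : good_rate_function J.
Proof.
split=> [x|c]; first by rewrite /J0; case: ifPn => // _; exact: I_good.1.
(* At a finite level, [J] cuts the compact level set of [I] by the closed set where the distance
   from [s] to [f x] vanishes. *)
rewrite (_ : [set x | _] = [set x | I x <= c%:E] `&`
    [set x | (mdist s (f x) <= 0)%R]).
  by apply: compact_closedI; [exact: I_good.2|exact: closed_constraint].
apply/seteqP; split => x /=; rewrite /J0 (leNgt (mdist _ _)) mdist_gt0 negbK eq_sym.
  by case: ifPn.
by case: ifPn => // _ [].
Qed.

Lemma lt_inf_constraint {F : set X} {c : R} : closed F ->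
  c%:E < ereal_inf (J @` F) ->
  \forall eta \near 0^'+, c%:E <=
    ereal_inf (I @` (F `&` [set x | (mdist s (f x) <= eta)%R])).
Proof.
move=> Fc cF; have /compact_near_coveringP Kc : compact ([set x | I x <= c%:E] `&` F).
  by apply: compact_closedI => //; exact: I_good.2.
have : \forall eta \near 0^'+, [set x | I x <= c%:E] `&` F `<=`
    [set x | (eta < mdist s (f x))%R].
  apply: (Kc R _ (fun eta x => (eta < mdist s (f x))%R)) => x [Ix Fx].
  (* If [f x] were [s], then [J x = I x <= c] would contradict [c < inf_F J]. *)
  have fx : (0 < mdist s (f x))%R.
    rewrite mdist_gt0 eq_sym; apply/negP => fxs; move: cF.
    rewrite ltNge => /negP; apply; apply: le_trans Ix.
    by apply: ge_ereal_inf; exists (J x); [exists x|rewrite /J0 fxs].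
  have fx2 : (mdist s (f x) / 2 < mdist s (f x))%R by rewrite gtr_pMr ?invf_lt1 ?ltr1n.
  near=> y eta => /=; apply: (@lt_trans _ _ (mdist s (f x) / 2)%R).
    by near: eta; apply: nbhs_right_lt; rewrite divr_gt0.
  by near: y; exact: (cvgr_gt _ (continuous_constraint x) _ fx2).
apply: filterS => eta Keta; apply: le_ereal_inf_tmp => _ [x [Fx xeta] <-].
rewrite leNgt; apply/negP => Ix; have := Keta x (conj (ltW Ix) Fx).
by rewrite /= ltNge xeta.
Unshelve. all: by end_near. Qed.

(** * Large deviation bounds for the conditional laws *)

Lemma cond_law_ge0 n eta A : 0 <= cond_law (mu n) (B eta) A.
Proof. by rewrite mule_ge0// inve_ge0. Qed.

Lemma cond_lower {U : set X} {eta} : open U -> (0 < eta)%R ->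
  - ereal_inf (J @` U) <=
  limn_einf (fun n => log_rate a n (cond_law (mu n) (B eta) U)).
Proof.
move=> Uo eta0; apply: lee_EFin_lt => c cU.
apply: limf_einf_ge_near; have UBo := openI Uo (fball_open eta).
have : c%:E < limn_einf (fun n => log_rate a n (mu n (U `&` B eta))).
  apply: lt_le_trans (mu_ldp.2 _ UBo); apply: lt_le_trans cU _; rewrite leeN2.
  (* A point of [U] with [f x = s] lies in every [B eta], and there [J] and [I] agree. *)
  apply: le_ereal_inf_tmp => _ [x Ux <-]; rewrite /J0.
  case: ifPn => [/eqP fx|_]; last exact: leey.
  apply: ge_ereal_inf; exists (I x) => //; exists x => //; split => //.
  by rewrite /fball/= fx mdistxx.
move=> /near_limf_einf_gt; apply: filterS => n /ltW/le_trans; apply.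
(* Dividing by [mu n (B eta) <= 1] can only increase the mass; if the divisor is 0, the mass of
   [U]&[B eta] is 0 as well. *)
apply: log_rate_mono => //.
have mB := borel_open _ (fball_open eta); have mUB := borel_open _ UBo.
have [B0|B0] := eqVneq (mu n (B eta)) 0.
  rewrite (_ : mu n (U `&` B eta) = 0) ?cond_law_ge0//.
  by apply: subset_measure0 mUB mB _ B0; exact: subIsetr.
have {B0} : 0 < mu n (B eta) by rewrite lt0e B0/=.
rewrite /cond_law; move: (probability_le1 (mu n) mB) (fin_num_measure (mu n) _ mB).
case: (mu n (B eta)) => // r; rewrite lee_fin lte_fin => r1 _ r0.
by rewrite inver gt_eqF// lee_pdivlMr// muleC gee_pMl// lee_fin ltW.
Qed.

Section negligible_cost.
Hypothesis cost0 : fball_negligible_cost f s a mu.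

Lemma cond_upper {F : set X} {c : R} : closed F -> c%:E < ereal_inf (J @` F) ->
  \forall eta \near 0^'+, \forall n \near \oo,
    log_rate a n (cond_law (mu n) (B eta) F) <= (- c)%:E.
Proof.
(* In [c < e < d < inf_F J], the gap from [d] to [e] turns the limit superior into an eventual
   bound, and the gap from [e] to [c] absorbs the division. *)
move=> Fc /lte_EFin_between[d cd dF].
have [e ce ed] := lte_EFin_between cd; rewrite !lte_fin in ce ed.
have := lt_inf_constraint Fc dF; apply: filter_app; near=> eta => deta.
have eta0 : (0 < eta)%R by near: eta; exact: nbhs_right_gt.
have FBc := closedI Fc (closed_constraint eta).
have mFB : measurable (F `&` B eta : set (borel X)).
  by apply: measurableI; [exact: borel_closed|apply: borel_open; exact: fball_open].
apply: (near_log_rate_div a_gt0 (- e)) => //.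
- by rewrite ltrN2.
- by move=> n; apply: fin_num_measure; apply: borel_open; exact: fball_open.
- exact: cost0.
(* The open constraint is enlarged to a closed one, to which the upper bound of the LDP applies. *)
have : limn_esup (fun n => log_rate a n
    (mu n (F `&` [set x | (mdist s (f x) <= eta)%R]))) < (- e)%:E.
  apply: le_lt_trans (mu_ldp.1 _ FBc) _.
  by rewrite EFinN lteN2; apply: lt_le_trans deta; rewrite lte_fin.
move=> /near_limf_esup_lt; apply: filterS => n /ltW; apply: le_trans.
apply: log_rate_mono => //; apply: le_measure; rewrite ?inE//.
  exact: borel_closed.
by apply: setIS => x; exact: ltW.
Unshelve. all: by end_near. Qed.

(** Ensures that the conditional law exists, so that the coupling at [(n, eta)] can be used. *)
Lemma near_fball_gt0 (eta : R) : (0 < eta)%R ->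
  \forall n \near \oo, 0 < mu n (B eta).
Proof.
move=> eta0; have := near_log_rate_gt _ _ (ltrN10 R) (cost0 _ eta0).
by apply: filterS => n; exact: (log_rate_gt_gt0 a_gt0).
Qed.

(** * Transfer of the bounds to the approximated laws *)

Section exp_good.
Variable nu : nat -> probability (borel X) R.
Hypothesis nu_approx : exp_good_approx a mu B nu.

Lemma exp_good_upper (F : set X) : closed F ->
  limn_esup (fun n => log_rate a n (nu n F)) <= - ereal_inf (J @` F).
Proof.
(* In [c < d' < c' < inf_F J], the level set at [c'] is separated from [F], [d'] bounds both terms
   of the coupling estimate, and the gap to [c] absorbs their sum. *)
move=> Fc; rewrite leeNr; apply: lee_EFin_lt => c /lte_EFin_between[c' cc' c'F].
have [d' cd' d'c'] := lte_EFin_between cc'; rewrite !lte_fin in cd' d'c'.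
rewrite leeNr; apply: limf_esup_le_near.
have KF : [set x | J x <= c'%:E] `&` F = set0.
  rewrite -subset0 => x [/= Jx Fx]; move: c'F; rewrite ltNge => /negP; apply.
  by apply: ge_ereal_inf; exists (J x) => //; exists x.
have [d d0 KFd] := thickening_disjoint (J0_good.2 c') Fc KF.
have Fdc : closed (thickening F d) by exact: closed_closure.
have d'Fd : d'%:E < ereal_inf (J @` thickening F d).
  apply: (@lt_le_trans _ _ c'%:E); first by rewrite lte_fin.
  apply: le_ereal_inf_tmp => _ [x Fdx <-]; rewrite leNgt; apply/negP => /ltW Jx.
  by have : ([set x | J x <= c'%:E] `&` thickening F d) x by []; rewrite KFd.
have [p [pc pfar]] := nu_approx _ d0.
(* [eta] is fixed before [n]: both bounds hold for small [eta], and then only eventually in [n]. *)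
near (0 : R)^'+ => eta.
have eta0 : (0 < eta)%R by near: eta; exact: nbhs_right_gt.
have cond : \forall n \near \oo,
    log_rate a n (cond_law (mu n) (B eta) (thickening F d)) <= (- d')%:E.
  by near: eta; exact: cond_upper.
have fars : \forall n \near \oo,
    log_rate a n (rp_prob (p n eta) (far (p n eta) d)) <= (- d')%:E.
  by near: eta; exact: near_far_le.
have d'c : (- d' < - c)%R by rewrite ltrN2.
near=> n.
have Bn : 0 < mu n (B eta) by near: n; exact: near_fball_gt0.
have condn : log_rate a n (cond_law (mu n) (B eta) (thickening F d)) <= (- d')%:E.
  by near: n.
have farn : log_rate a n (rp_prob (p n eta) (far (p n eta) d)) <= (- d')%:E.
  by near: n.
have [pn mfar] := pc n eta eta0 Bn.
have sum_le : forall q1 q2 : \bar R, 0 <= q1 -> 0 <= q2 ->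
    log_rate a n q1 <= (- d')%:E -> log_rate a n q2 <= (- d')%:E ->
    log_rate a n (q1 + q2) <= (- c)%:E by near: n; exact: near_log_rateD.
apply: (@le_trans _ _ (log_rate a n (cond_law (mu n) (B eta) (thickening F d) +
    rp_prob (p n eta) (far (p n eta) d)))).
  apply: log_rate_mono => //; apply: (coupling_le_fst pn mfar).
  - exact: borel_closed.
  - exact: borel_closed.
  - by move=> x y Fx xy; apply: subset_closure; exists x.
exact: sum_le (cond_law_ge0 _ _ _) _ condn farn.
Unshelve. all: by end_near. Qed.

Lemma exp_good_lower (U : set X) : open U ->
  - ereal_inf (J @` U) <= limn_einf (fun n => log_rate a n (nu n U)).
Proof.
move=> Uo; rewrite leeNl; apply: le_ereal_inf_tmp => _ [x Ux <-].
rewrite leeNl; apply: lee_EFin_lt => c /lte_EFin_between[d].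
rewrite lte_fin => cd dx; apply: limf_einf_ge_near.
have /nbhs_ballP[r /= r0 xrU] : nbhs x U by exact: open_nbhs_nbhs.
(* Half the radius goes to the ball [G], half to the coupling distance, so that points paired with
   [G] stay in [U]. *)
have r2 : (0 < r / 2)%R by rewrite divr_gt0.
pose G : set X := ball x (r / 2).
have Go : open G.
  rewrite /G ballEmdist.
  apply: (@open_comp _ _ (mdist x) [set t : R | (t < r / 2)%R]) => //.
  by move=> y _; exact: continuous_mdist.
have [p [pc pfar]] := nu_approx _ r2.
near (0 : R)^'+ => eta.
have eta0 : (0 < eta)%R by near: eta; exact: nbhs_right_gt.
have cond : \forall n \near \oo, d%:E < log_rate a n (cond_law (mu n) (B eta) G).
  apply: near_limf_einf_gt; apply: lt_le_trans (cond_lower Go eta0).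
  apply: (lt_le_trans dx); rewrite leeN2; apply: ge_ereal_inf; exists (J x) => //.
  by exists x => //; exact: ballxx.
have fars : \forall n \near \oo,
    log_rate a n (rp_prob (p n eta) (far (p n eta) (r / 2))) <= c%:E.
  by near: eta; exact: near_far_le.
near=> n.
have Bn : 0 < mu n (B eta) by near: n; exact: near_fball_gt0.
have condn : d%:E < log_rate a n (cond_law (mu n) (B eta) G) by near: n.
have farn : log_rate a n (rp_prob (p n eta) (far (p n eta) (r / 2))) <= c%:E.
  by near: n.
have [pn mfar] := pc n eta eta0 Bn.
have sum_le : forall q1 q2 : \bar R, 0 <= q1 -> 0 <= q2 ->
    log_rate a n q1 <= c%:E -> log_rate a n q2 <= c%:E ->
    log_rate a n (q1 + q2) <= d%:E by near: n; exact: near_log_rateD.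
(* Were [nu n U] at most [expR (c / a n)] like the far term, their sum, and with it the conditional
   mass of [G], would fall to level [d] or below. *)
rewrite leNgt; apply/negP => /ltW nuUn; move: condn; rewrite ltNge => /negP; apply.
apply: (@le_trans _ _ (log_rate a n (nu n U +
    rp_prob (p n eta) (far (p n eta) (r / 2))))).
  apply: log_rate_mono; [by []|exact: cond_law_ge0|apply: (coupling_le_snd pn mfar)].
  - exact: borel_open.
  - exact: borel_open.
  - move=> y z; rewrite /G ballEmdist/= => xz yz; apply: xrU; rewrite ballEmdist/=.
    by have := metric_triangle x z y; rewrite (metric_sym z y); lra.
exact: sum_le.
Unshelve. all: by end_near. Qed.

End exp_good.
End negligible_cost.
End constrained_ldp.

Theorem proposition2p1 (R : realType) (X : pmetricType R) (S : metricType R)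
    (a : nat -> R) (mu : nat -> probability (borel X) R) (I : X -> \bar R)
    (f : X -> S) (s : S)
    (a_gt0 : forall n : nat, (0 < a n)%R)
    (a_cvg0 : a @ \oo --> (0 : R)%R)
    (I_good : good_rate_function I)
    (mu_ldp : ldp a mu I)
    (f_cont : continuous f) :
  (fball_negligible_cost f s a mu ->
     good_rate_function (J0 f s I) /\
     (forall U : set X, open U ->
        - ereal_inf (J0 f s I @` U) <=
        limf_einf (fun eta : R => limn_einf (fun n : nat =>
          log_rate a n (cond_law (mu n) (fball f s eta) U))) 0^'+) /\
     (forall F : set X, closed F ->
        limf_esup (fun eta : R => limn_esup (fun n : nat =>
          log_rate a n (cond_law (mu n) (fball f s eta) F))) 0^'+ <=
        - ereal_inf (J0 f s I @` F)))
  /\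
  (forall nu : nat -> probability (borel X) R,
     fball_negligible_cost f s a mu ->
     exp_good_approx a mu (fball f s) nu ->
     good_rate_function (J0 f s I) /\ ldp a nu (J0 f s I)).
Proof.
split=> [cost0|nu cost0 nu_approx]; last first.
  split; first exact: J0_good.
  by split=> [F Fc|U Uo]; [exact: (exp_good_upper a_gt0 a_cvg0 I_good mu_ldp f_cont cost0 _ nu_approx)
    |exact: (exp_good_lower a_gt0 a_cvg0 mu_ldp f_cont cost0 _ nu_approx)].
split; first exact: J0_good.
split=> [U Uo|F Fc].
  apply: limf_einf_ge_near; near=> eta.
  have eta0 : (0 < eta)%R by near: eta; exact: nbhs_right_gt.
  exact: (cond_lower a_gt0 mu_ldp f_cont Uo eta0).
rewrite leeNr; apply: lee_EFin_lt => c cF; rewrite leeNr.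
apply: limf_esup_le_near; have := cond_upper a_gt0 I_good mu_ldp f_cont cost0 Fc cF.
by apply: filterS => eta; exact: limf_esup_le_near.
Unshelve. all: by end_near. Qed.
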